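(* Let $\omega^\omega=\sum_n\omega^n$ denote the countable ordinal (ordinal exponentiation), and let $\mathcal F$ be the filter on the set $\omega^\omega$ consisting of all $A\subseteq\omega^\omega$ such that the order type of $\omega^\omega\setminus A$ is less than $\omega^\omega$. Then $\mathcal F$ is homogeneous and isomorphic to $\mathcal F\times\omega$.
   Context: For a filter $\mathcal F$ on a countably infinite set $S$: $\mathcal F^+$ is the family of all $X\subset S$ meeting every member of $\mathcal F$; $\mathcal F\restriction X=\{F\cap X:F\in\mathcal F\}$ is the restriction of $\mathcal F$ to $X$; $\mathcal F\times\omega$ is the filter on $S\times\omega$ generated by the sets $F\times\omega$, $F\in\mathcal F$. Filters $\mathcal F$ on $A$ and $\mathcal G$ on $B$ are isomorphic if some bijection $t:A\to B$ satisfies $S'\in\mathcal F\iff t(S')\in\mathcal G$ for all $S'\subset A$. $\mathcal F$ is homogeneous if $\mathcal F\restriction X$ is isomorphic to $\mathcal F$ for every $X\in\mathcal F^+$. *)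

(* Defs.v *)
From Stdlib Require Import Relation_Operators Wellfounded Wf_nat.
From mathcomp Require Import all_boot.
From mathcomp Require Import boolp classical_sets filter.

Set Implicit Arguments.
Unset Strict Implicit.
Unset Printing Implicit Defensive.

Local Open Scope classical_set_scope.

Section Filters.

Definition positive_sets (S : Type) (F : set_system S) : set_system S :=
  [set X | forall A, F A -> X `&` A !=set0].

(* The trace F `&` X of F is viewed as a subset of the subtype carried by X. *)
Definition restriction (S : Type) (F : set_system S) (X : set S) :
    set_system (set_type X) :=
  [set [set x : set_type X | A (val x)] | A in F].
Arguments restriction {S} F X _.

Definition times_omega (S : Type) (F : set_system S) : set_system (S * nat) :=
  smallest (fun G : set_system (S * nat) => Filter G)
    [set A `*` [set: nat] | A in F].

Definition filter_iso (A B : Type) (F : set_system A) (G : set_system B) :=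
  exists t : A -> B, bijective t /\ forall S : set A, F S <-> G (t @` S).

Definition homogeneous (S : Type) (F : set_system S) :=
  forall X : set S, positive_sets F X -> filter_iso (restriction F X) F.

End Filters.

(* Transitivity is a consequence of well-foundedness and trichotomy, see
   wo_trans below. *)
Record wellorder := WellOrder {
  wo_sort :> Type;
  wo_lt : wo_sort -> wo_sort -> Prop;
  wo_wf : well_founded wo_lt;
  wo_trichotomy : forall x y, [\/ wo_lt x y, x = y | wo_lt y x]
}.

Lemma wo_trans (W : wellorder) (x y z : W) :
  wo_lt x y -> wo_lt y z -> wo_lt x z.
Proof.
move=> xy yz.
have [//|xz|zx] := wo_trichotomy x z.
  have: forall a, Acc (@wo_lt W) a -> forall b, wo_lt a b -> wo_lt b a -> False.
    by move=> a; elim=> {}a _ IH b ab ba; apply: (IH b ba a).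
  by rewrite -xz in yz; move=> /(_ x (wo_wf x) y xy yz).
have: forall a, Acc (@wo_lt W) a ->
    forall b c, wo_lt a b -> wo_lt b c -> wo_lt c a -> False.
  by move=> a; elim=> {}a _ IH b c ab bc ca; apply: (IH c ca a b).
by move=> /(_ x (wo_wf x) y z xy yz zx).
Qed.

Section SubOrder.
Variables (W : wellorder) (X : set W).

Definition wo_sub_lt (x y : set_type X) : Prop := wo_lt (val x) (val y).

Lemma wo_sub_wf : well_founded wo_sub_lt.
Proof. exact: wf_inverse_image (@wo_wf W). Qed.

Lemma wo_sub_trichotomy x y : [\/ wo_sub_lt x y, x = y | wo_sub_lt y x].
Proof.
have [xy|/val_inj xy|yx] := wo_trichotomy (val x) (val y).
- exact: Or31.
- exact: Or32.
- exact: Or33.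
Qed.

Definition wo_sub := WellOrder wo_sub_wf wo_sub_trichotomy.

End SubOrder.

Definition same_order_type (V W : wellorder) :=
  exists f : V -> W,
    bijective f /\ forall x y, wo_lt x y <-> wo_lt (f x) (f y).

(* The order type of V is less than that of W when V is isomorphic to a proper
   initial segment of W. *)
Definition order_type_lt (V W : wellorder) :=
  exists w : W, same_order_type V (wo_sub [set x | wo_lt x w]).

(* The ordinal sum of a well-ordered family, with its lexicographic order. *)
Section Sum.
Variables (I : wellorder) (V : I -> wellorder).

Definition wo_sum_lt : {i : I & V i} -> {i : I & V i} -> Prop :=
  lexprod I V (@wo_lt I) (fun i => @wo_lt (V i)).

Lemma wo_sum_wf : well_founded wo_sum_lt.
Proof.
apply: wf_lexprod; first exact: wo_wf.
by move=> i; exact: wo_wf.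
Qed.

Lemma wo_sum_trichotomy x y : [\/ wo_sum_lt x y, x = y | wo_sum_lt y x].
Proof.
case: x y => [i a] [j b].
have [ij|ij|ji] := wo_trichotomy i j.
- by apply: Or31; apply: left_lex.
- case: _ / ij b => b; have [ab|->|ba] := wo_trichotomy a b.
  + by apply: Or31; apply: right_lex.
  + exact: Or32.
  + by apply: Or33; apply: right_lex.
- by apply: Or33; apply: left_lex.
Qed.

Definition wo_sum := WellOrder wo_sum_wf wo_sum_trichotomy.

End Sum.

(* The ordinal product V * W is W copies of V, so W is the most significant
   coordinate. *)
Definition wo_mul (V W : wellorder) : wellorder := wo_sum (fun _ : W => V).

Lemma unit_trichotomy (x y : unit) : [\/ False, x = y | False].
Proof. by apply: Or32; case: x; case: y. Qed.

Definition wo_one : wellorder :=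
  @WellOrder unit (fun _ _ => False) (fun x => Acc_intro x (fun _ => False_ind _))
    unit_trichotomy.

Lemma nat_wf : well_founded (fun m n : nat => m < n : Prop).
Proof. by apply: (well_founded_lt_compat _ id) => m n /ltP. Qed.

Lemma nat_trichotomy (m n : nat) : [\/ m < n, m = n | n < m].
Proof.
have [mn|nm|mn] := ltngtP m n.
- exact: Or31.
- exact: Or33.
- exact: Or32.
Qed.

Definition omega : wellorder := WellOrder nat_wf nat_trichotomy.

Fixpoint omega_pow (n : nat) : wellorder :=
  if n is n'.+1 then wo_mul (omega_pow n') omega else wo_one.

Definition omega_omega : wellorder := wo_sum (fun n : omega => omega_pow n).

Definition omega_omega_filter : set_system omega_omega :=
  [set A | order_type_lt (wo_sub (~` A)) omega_omega].

(* Main.v *)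
Require Import Defs.
From mathcomp Require Import all_boot.
From mathcomp Require Import boolp classical_sets filter.

Set Implicit Arguments.
Unset Strict Implicit.
Unset Printing Implicit Defensive.

Local Open Scope classical_set_scope.

(** Order types below [omega^omega] are handled through embeddings: a set is
called small if it embeds increasingly in some [omega^n].  Because any two
well-orders are comparable ([order_type_trichotomy]), being small is the same as
having order type less than [omega^omega] ([small_order_type_lt]), and
[omega^omega] is characterized as the well-order that is not small but all of
whose proper initial segments are small ([omega_omega_order_type]).

Three facts about small sets then give everything.

- They are closed under union ([small_setU]), by coordinatewise addition in
  [omega^n].  Since [omega^omega] itself is not small, the sets with small
  complement form a proper filter.

- A positive set [X] is not small, since otherwise its complement would be a
  member of the filter.  Its proper initial segments are small, so [X], with the
  induced order, is isomorphic to [omega^omega].  The isomorphism preserves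
  smallness of subsets, hence carries the restricted filter to the whole filter.

- A set of pairs in the product [omega * omega^omega] is small if and only if
  its projection to [omega^omega] is small ([small_projection]), because a set
  of order type at most [omega^n] becomes one of order type at most [omega^n.+1]
  when each point is replaced by a copy of [omega].  So this product is not
  small, has small initial segments, and is therefore isomorphic to
  [omega^omega] ([omega_mul_omega_omega]).  A set belongs to the product of the
  filter with [omega] exactly when the projection of its complement is small,
  so the same isomorphism, read as a bijection onto the set of pairs, is an
  isomorphism of filters. *)

(** * Comparability of well-orders *)

Lemma wo_irrefl (W : wellorder) (x : W) : ~ wo_lt x x.
Proof. by elim: (wo_wf x) => {}x _ IH lt_xx; exact: (IH _ lt_xx lt_xx). Qed.

Lemma wo_min (W : wellorder) (P : set W) : P !=set0 ->
  exists2 m, P m & forall x, P x -> ~ wo_lt x m.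
Proof.
move=> [x]; elim: (wo_wf x) => {}x _ IH Px.
have [[y Py yx]|nex] := pselect (exists2 y, P y & wo_lt y x).
  exact: IH yx Py.
by exists x => // y Py yx; apply: nex; exists y.
Qed.

Definition increasing_on (V W : wellorder) (A : set V) (f : V -> W) :=
  forall x y, A x -> A y -> wo_lt x y -> wo_lt (f x) (f y).

(** At a least counterexample [x], applying [f] to [f x < x] makes [f x] a smaller
one. *)
Lemma increasing_self_map (W : wellorder) (f : W -> W) :
  increasing_on setT f -> forall x, ~ wo_lt (f x) x.
Proof.
move=> fI x; elim: (wo_wf x) => {}x _ IH fx.
by apply: (IH _ fx); exact: fI.
Qed.

(** The last hypothesis already makes [R] functional and injective, since two
incomparable elements of a well-order are equal. *)
Lemma same_order_type_correspondence (V W : wellorder) (R : V -> W -> Prop) :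
  (forall v, exists w, R v w) -> (forall w, exists v, R v w) ->
  (forall v v' w w', R v w -> R v' w' -> wo_lt v v' <-> wo_lt w w') ->
  same_order_type V W.
Proof.
move=> /choice[f Rf] /choice[g Rg] Rlt; exists f; split.
  exists g.
    move=> v; have e := Rlt _ _ _ _ (Rg (f v)) (Rf v).
    have e' := Rlt _ _ _ _ (Rf v) (Rg (f v)).
    by have [/e/wo_irrefl|//|/e'/wo_irrefl] := wo_trichotomy (g (f v)) v.
  move=> w; have e := Rlt _ _ _ _ (Rg w) (Rf (g w)).
  have e' := Rlt _ _ _ _ (Rf (g w)) (Rg w).
  by have [/e'/wo_irrefl|//|/e/wo_irrefl] := wo_trichotomy (f (g w)) w.
by move=> x y; exact: Rlt (Rf x) (Rf y).
Qed.

(** By well-founded recursion, [matched v w] says that the initial segments below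
[v] and [w] are isomorphic; stating it without isomorphisms makes it symmetric
and free of choices. *)
Inductive matched (V W : wellorder) (v : V) (w : W) : Prop := Matched of
  (forall v', wo_lt v' v -> exists2 w', wo_lt w' w & matched v' w') &
  (forall w', wo_lt w' w -> exists2 v', wo_lt v' v & matched v' w').

Lemma matched_sym (V W : wellorder) (v : V) (w : W) :
  matched v w -> matched w v.
Proof.
elim: (wo_wf v) w => {}v _ IH w [vw wv]; split.
  by move=> w' /wv[v' v'v m]; exists v' => //; exact: IH.
by move=> v' v'v; have [w' w'w m] := vw _ v'v; exists w' => //; exact: IH.
Qed.

Lemma matched_fun (V W : wellorder) (v : V) (w w' : W) :
  matched v w -> matched v w' -> w = w'.
Proof.
elim: (wo_wf v) w w' => {}v _ IH.
suff nlt (w w' : W) : matched v w -> matched v w' -> ~ wo_lt w w'.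
  move=> w w' m m'.
  by have [/(nlt _ _ m m')|//|/(nlt _ _ m' m)] := wo_trichotomy w w'.
move=> [vw _] [_ wv] /wv[u uv mu]; have [w2 w2w mu2] := vw _ uv.
by rewrite (IH _ uv _ _ mu mu2) in w2w; exact: wo_irrefl w2w.
Qed.

Lemma matched_increasing (V W : wellorder) (v v' : V) (w w' : W) :
  matched v w -> matched v' w' -> wo_lt v v' -> wo_lt w w'.
Proof.
move=> m [vw _] /vw[u uw' mu].
by rewrite (matched_fun m mu).
Qed.

Lemma matched_lt (V W : wellorder) (v v' : V) (w w' : W) :
  matched v w -> matched v' w' -> wo_lt v v' <-> wo_lt w w'.
Proof.
move=> m m'; split; first exact: matched_increasing m m'.
exact: matched_increasing (matched_sym m) (matched_sym m').
Qed.

(** The set of matched points of [W] is closed downwards, so it is the initial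
segment below the least point that it misses. *)
Lemma matched_total_lt (V W : wellorder) :
  (forall v : V, exists w : W, matched v w) ->
  (exists w : W, forall v : V, ~ matched v w) -> order_type_lt V W.
Proof.
move=> tot /wo_min[w0 nw0 min0].
have below (w : W) : wo_lt w w0 -> exists v : V, matched v w.
  move=> ww0; apply: contrapT => nex; apply: (min0 w _ ww0) => v m.
  by apply: nex; exists v.
exists w0.
apply: (@same_order_type_correspondence V (wo_sub [set x | wo_lt x w0])
  (fun v w => matched v (val w))).
- move=> v; have [w m] := tot v; suff ww0 : wo_lt w w0.
    by exists (exist _ w (mem_set ww0)).
  have [//|ww0|w0w] := wo_trichotomy w w0; first by case: (nw0 v); rewrite -ww0.
  by case: m => _ /(_ _ w0w)[u _ /nw0].
- by move=> [w /= /set_mem /below].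
- by move=> v v' w w'; exact: matched_lt.
Qed.

(** If the matching missed points on both sides, the least missed points would be
matched with each other. *)
Lemma order_type_trichotomy (V W : wellorder) :
  [\/ order_type_lt V W, same_order_type V W | order_type_lt W V].
Proof.
have [totV|/existsNP[v1 nv1]] :=
    pselect (forall v : V, exists w : W, matched v w).
  have [totW|/existsNP[w nw]] :=
      pselect (forall w : W, exists v : V, matched v w).
    by apply: Or32; apply: same_order_type_correspondence totV totW _;
      exact: matched_lt.
  apply: Or31; apply: matched_total_lt totV _; exists w => v m.
  by apply: nw; exists v.
have [totW|/existsNP[w1 nw1]] :=
    pselect (forall w : W, exists v : V, matched v w).
  apply: Or33; apply: matched_total_lt.
    by move=> w; have [v /matched_sym m] := totW w; exists v.
  by exists v1 => w /matched_sym m; apply: nv1; exists w.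
(* Neither side is exhausted: match the least unmatched points v and w. *)
have [v nv minv] : exists2 v : V, ~ (exists w : W, matched v w) &
    forall x : V, ~ (exists w : W, matched x w) -> ~ wo_lt x v.
  by apply: wo_min; exists v1.
have [w nw minw] : exists2 w : W, ~ (exists v : V, matched v w) &
    forall x : W, ~ (exists v : V, matched v x) -> ~ wo_lt x w.
  by apply: wo_min; exists w1.
have nv' := nv; case: nv; exists w; split.
  move=> x xv; have /contrapT[y m] : ~ ~ exists w : W, matched x w.
    by move=> /minv; exact.
  exists y => //; have [//|yw|wy] := wo_trichotomy y w.
    by case: nw; exists x; rewrite -yw.
  by case: m => _ /(_ _ wy)[u _ mu]; case: nw; exists u.
move=> y yw; have /contrapT[x m] : ~ ~ exists v : V, matched v y.
  by move=> /minw; exact.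
exists x => //; have [//|xv|vx] := wo_trichotomy x v.
  by case: nv'; exists y; rewrite -xv.
by case: m => /(_ _ vx)[u _ mu] _; case: nv'; exists u.
Qed.

(** * Digits of elements of a power of omega *)

(** For a constant family the lexicographic order can be read from the projections,
without transport along an equality of indices. *)
Lemma wo_mul_ltP (V W : wellorder) (x y : wo_mul V W) :
  wo_lt x y <-> wo_lt (projT1 x) (projT1 y) \/
                projT1 x = projT1 y /\ wo_lt (projT2 x) (projT2 y).
Proof.
split; first by case=> [i j a b ij|i a b ab]; [left|right].
case: x y => [i a] [j b] /= [ij|[<- ab]]; first exact: Relation_Operators.left_lex.
exact: Relation_Operators.right_lex.
Qed.

(** Adds a most significant digit. *)
Definition cons_digit n (k : nat) (a : omega_pow n) : omega_pow n.+1 :=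
  existT (fun _ : omega => omega_pow n) k a.

Lemma cons_digit_lt n k (a b : omega_pow n) :
  wo_lt a b -> wo_lt (cons_digit k a) (cons_digit k b).
Proof. by move=> ab; apply/wo_mul_ltP; right. Qed.

Fixpoint omega_pow_zero n : omega_pow n :=
  if n is n'.+1 then cons_digit 0 (omega_pow_zero n') else tt.

(** This is the natural (Hessenberg) sum.  Unlike ordinal addition it is strictly
increasing in both arguments. *)
Fixpoint digit_add n : omega_pow n -> omega_pow n -> omega_pow n :=
  if n is n'.+1 then fun x y : wo_mul (omega_pow n') omega =>
    cons_digit (projT1 x + projT1 y) (digit_add (projT2 x) (projT2 y))
  else fun _ _ => tt.

Lemma digit_addC n : commutative (@digit_add n).
Proof.
by elim: n => [|n IH] //= x y; rewrite addnC IH.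
Qed.

Lemma digit_add_lt n (a a' b : omega_pow n) :
  wo_lt a a' -> wo_lt (digit_add a b) (digit_add a' b).
Proof.
elim: n a a' b => [|n IH] //= a a' b /wo_mul_ltP aa'.
apply/wo_mul_ltP => /=; case: aa' => [lt1|[-> lt2]].
  by left; rewrite ltn_add2r.
by right; split=> //; exact: IH.
Qed.

Lemma digit_add_lt_le n (a a' b b' : omega_pow n) :
  wo_lt a a' -> ~ wo_lt b' b -> wo_lt (digit_add a b) (digit_add a' b').
Proof.
move=> aa' b'b; have [bb'|<-|//] := wo_trichotomy b b'; last exact: digit_add_lt.
apply: wo_trans (digit_add_lt b aa') _.
by rewrite !(digit_addC a'); exact: digit_add_lt.
Qed.

(** Adds a least significant digit, which realizes the embedding of
[omega * omega^n] in [omega^n.+1]. *)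
Fixpoint rcons_digit n : omega_pow n -> nat -> omega_pow n.+1 :=
  if n is n'.+1 then fun (x : wo_mul (omega_pow n') omega) k =>
    cons_digit (projT1 x) (rcons_digit (projT2 x) k)
  else fun x k => cons_digit k x.

Lemma rcons_digit_ltl n (a b : omega_pow n) k l :
  wo_lt a b -> wo_lt (rcons_digit a k) (rcons_digit b l).
Proof.
elim: n a b => [|n IH] //= a b /wo_mul_ltP ab; apply/wo_mul_ltP => /=.
by case: ab => [ab|[ab1 /IH ab2]]; [left|right].
Qed.

Lemma rcons_digit_ltr n (a : omega_pow n) k l :
  k < l -> wo_lt (rcons_digit a k) (rcons_digit a l).
Proof.
move=> kl; elim: n a => [|n IH] a; apply/wo_mul_ltP; first by left.
by right; split=> //=; exact: IH.
Qed.

(** * Sets that embed in a power of omega *)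

(** The map is total, with no condition outside [A], so that maps on different
subsets of [V] can be combined without changing types. *)
Definition small_at n (V : wellorder) (A : set V) :=
  exists f : V -> omega_pow n, increasing_on A f.

Definition small (V : wellorder) (A : set V) := exists n, small_at n A.

Lemma small_at_leq n m (V : wellorder) (A : set V) :
  n <= m -> small_at n A -> small_at m A.
Proof.
move=> /subnKC <-; elim: (m - n) => [|k IH]; first by rewrite addn0.
rewrite addnS => /IH[f fI]; exists (cons_digit 0 \o f) => x y Ax Ay xy /=.
by apply: cons_digit_lt; exact: fI.
Qed.

Lemma small_comap (V W : wellorder) (A : set V) (B : set W) (g : V -> W) :
  (forall x, A x -> B (g x)) -> increasing_on A g -> small B -> small A.
Proof.
move=> AB gI [n [f fI]]; exists n, (f \o g) => x y Ax Ay xy.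
by apply: fI; [exact: AB|exact: AB|exact: gI].
Qed.

Lemma small_embedding (V W : wellorder) (B : set W) (h : V -> wo_sub B) :
  increasing_on setT h -> small B -> small [set: V].
Proof.
move=> hI; apply: (@small_comap _ _ _ _ (fun x => val (h x))).
  by move=> x _; have /set_mem := valP (h x).
by move=> x y _ _ /(hI x y I I).
Qed.

Lemma sub_small (V : wellorder) (A B : set V) : A `<=` B -> small B -> small A.
Proof. by move=> AB; exact: (@small_comap V V A B id). Qed.

Lemma small_set1 (V : wellorder) (v : V) : small [set v].
Proof.
exists 0, (fun _ => tt) => x y /= -> ->; exact: wo_irrefl.
Qed.

(** Let [F x] be the value of the embedding at the first point of [A] that is not
below [x], or a new top value if there is none.  This extends the embedding of
[A] to a weakly increasing map on all of [V] that increases strictly at each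
point of [A]; the additional leading digit makes room for the top value. *)
Lemma increasing_ceiling n (V : wellorder) (A : set V) : small_at n A ->
  exists F : V -> omega_pow n.+1,
    forall x y, wo_lt x y -> ~ wo_lt (F y) (F x) /\ (A x -> wo_lt (F x) (F y)).
Proof.
move=> [f fI].
have /choice[F FP] x : exists z : omega_pow n.+1,
    (exists m, [/\ A m, ~ wo_lt m x, forall a, A a -> ~ wo_lt a x -> ~ wo_lt a m
               & z = cons_digit 0 (f m)]) \/
    (forall a, A a -> wo_lt a x) /\ z = cons_digit 1 (omega_pow_zero n).
  have [/wo_min[m [Am mx] minm]|nex] :=
      pselect ([set a | A a /\ ~ wo_lt a x] !=set0).
    exists (cons_digit 0 (f m)); left; exists m; split=> // a Aa ax.
    exact: minm.
  exists (cons_digit 1 (omega_pow_zero n)); right; split=> // a Aa.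
  by apply: contrapT => ax; apply: nex; exists a.
have top a b : wo_lt (@cons_digit n 0 a) (cons_digit 1 b).
  by apply/wo_mul_ltP; left.
exists F => x y xy.
case: (FP x) => [[m [Am mx minm Fx]]|[Ax Fx]];
    case: (FP y) => [[k [Ak ky mink Fy]]|[Ay Fy]]; rewrite Fx Fy.
- have xk : wo_lt x k.
    by have [ky'|->//|yk] := wo_trichotomy k y; last exact: wo_trans yk.
  (* m and k are the first points of A not below x and y; x < k gives m <= k. *)
  have [km|km|mk] := wo_trichotomy k m.
  + by case: (minm k Ak _ km) => kx; apply: (@wo_irrefl _ x); exact: wo_trans kx.
  + subst k; split; first exact: wo_irrefl.
    by move=> Ax; case: (minm x Ax (@wo_irrefl _ x) xk).
  + have lt := cons_digit_lt 0 (fI _ _ Am Ak mk).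
    split=> // lt'; apply: (@wo_irrefl _ (cons_digit 0 (f m))).
    exact: wo_trans lt lt'.
- split=> [lt|_]; last exact: top.
  by apply: wo_irrefl (wo_trans lt (top _ _)).
- by case: ky; apply: wo_trans xy; exact: Ax.
- by split=> [|/Ax/wo_irrefl//]; exact: wo_irrefl.
Qed.

(** Extend the embeddings of [A] and [B] to weakly increasing maps on [V].  Their
natural sum increases strictly wherever one of them does, that is, at each point
of the union. *)
Lemma small_setU (V : wellorder) (A B : set V) :
  small A -> small B -> small (A `|` B).
Proof.
move=> [n /(small_at_leq (leq_maxl n _))A_] [m /(small_at_leq (leq_maxr _ m))B_].
have [F FP] := increasing_ceiling (A_ m).
have [G GP] := increasing_ceiling (B_ n).
exists (maxn n m).+1, (fun x => digit_add (F x) (G x)) => x y ABx _ xy.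
have [Fle Flt] := FP _ _ xy; have [Gle Glt] := GP _ _ xy.
case: ABx => [/Flt lt|/Glt lt]; first exact: digit_add_lt_le.
by rewrite digit_addC (digit_addC (F y)); exact: digit_add_lt_le.
Qed.

Lemma small_val_image (V : wellorder) (X : set V) (A : set (wo_sub X)) :
  small ([set val x | x in A] : set V) <-> small A.
Proof.
split.
  by apply: (@small_comap (wo_sub X) V A _ (fun x => val x)) => // x Ax; exists x.
move=> [n [f fI]].
have /choice[F FP] x : exists z, forall xX : x \in X, z = f (exist _ x xX).
  have [xX|nxX] := pselect (x \in X); last by exists (omega_pow_zero n).
  by exists (f (exist _ x xX)) => xX'; congr f; exact: val_inj.
exists n, F => _ _ [[x Xx] Ax <-] [[y Xy] Ay <-] xy /=.
by rewrite (FP _ Xx) (FP _ Xy); exact: fI.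
Qed.

Lemma small_wo_sub (V : wellorder) (A : set V) :
  @small (wo_sub A) setT <-> small A.
Proof.
rewrite -small_val_image; suff -> : [set val x | x in [set: wo_sub A]] = A by [].
apply/seteqP; split=> [_ [[x xA] _ <-]|x /mem_set xA]; first exact: set_mem.
by exists (exist _ x xA).
Qed.

(** * Small sets and order types below omega^omega *)

Lemma omega_omega_lt_leq (x y : omega_omega) :
  wo_lt x y -> projT1 x <= projT1 y.
Proof. by case=> [i j a b ij|i a b ab] //=; exact: ltnW. Qed.

Lemma small_power_block n : small [set x : omega_omega | projT1 x = n].
Proof.
pose f (x : omega_omega) : omega_pow n :=
  if projT1 x =P n is ReflectT e then
    eq_rect (projT1 x) (fun k => wo_sort (omega_pow k)) (projT2 x) n e
  else omega_pow_zero n.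
exists n, f => x y + + xy; rewrite /f; case: xy => [i j a b ij|i a b ab] /=.
  by move=> ein ejn; exfalso; move: ij; rewrite /= ein ejn ltnn.
move=> ein _; case: eqP => // e; subst n.
by rewrite (eq_irrelevance e erefl).
Qed.

(** The blocks below [n] form a finite union of small sets, which spares an explicit
embedding of their ordinal sum. *)
Lemma small_lower_blocks n : small [set x : omega_omega | projT1 x < n].
Proof.
elim: n => [|n IH]; first by exists 0, (fun _ => tt).
apply: sub_small (small_setU IH (small_power_block n)) => x /=.
by rewrite ltnS leq_eqVlt => /orP[/eqP|]; [right|left].
Qed.

Lemma small_initial_segment (w : omega_omega) : small [set x | wo_lt x w].
Proof.
apply: sub_small (small_lower_blocks (projT1 w).+1) => x /=.
by rewrite ltnS; exact: omega_omega_lt_leq.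
Qed.

(** An embedding of [omega^omega] in [omega^n], followed by the inclusion of the
block [omega^n], would be an increasing self-map sending the points of the next
block below themselves. *)
Lemma omega_omega_not_small : ~ small [set: omega_omega].
Proof.
move=> [n [f fI]].
pose in_block k a : omega_omega := existT (fun k : omega => omega_pow k) k a.
apply: (@increasing_self_map _ (in_block n \o f) _
         (in_block n.+1 (omega_pow_zero _))).
  by move=> x y _ _ xy; apply: Relation_Operators.right_lex; exact: fI.
by apply: Relation_Operators.left_lex; exact: ltnSn.
Qed.

(** A small set that is not of smaller order type than [omega^omega] would contain a
copy of [omega^omega], which would then be small. *)
Lemma small_order_type_lt (V : wellorder) (A : set V) :
  order_type_lt (wo_sub A) omega_omega <-> small A.
Proof.
split.
  rewrite -small_wo_sub => -[w [h [_ hI]]].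
  by apply: (small_embedding (h := h)) (small_initial_segment w) => x y _ _ /hI.
move=> sA; have not_embed (g : omega_omega -> wo_sub A) :
    ~ increasing_on setT g.
  by move=> gI; apply: omega_omega_not_small; exact: small_embedding gI sA.
have [//|[h [[g hK gK] hI]]|[a [h [_ hI]]]] :=
    order_type_trichotomy (wo_sub A) omega_omega.
  by case: (not_embed g) => x y _ _ xy; apply/hI; rewrite !gK.
by case: (not_embed (val \o h)) => x y _ _ /hI.
Qed.

(** By comparability: a smaller order type would make [V] small, and a larger one
would make [omega^omega] isomorphic to a proper initial segment of [V], hence
small. *)
Lemma omega_omega_order_type (V : wellorder) :
  ~ small [set: V] -> (forall v : V, small [set x | wo_lt x v]) ->
  same_order_type V omega_omega.
Proof.
move=> nsV segV; have [[w]|//|[v]] := order_type_trichotomy V omega_omega.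
  move=> [h [_ hI]]; case: nsV.
  by apply: (small_embedding (h := h)) (small_initial_segment w) => x y _ _ /hI.
move=> [h [_ hI]]; case: omega_omega_not_small.
by apply: (small_embedding (h := h)) (segV v) => x y _ _ /hI.
Qed.

(** Choosing one point in each nonempty fibre is increasing, so the projection of a
small set is small.  Conversely, an embedding of the projection is refined by
using the [omega] coordinate as a least significant digit. *)
Lemma small_projection (W : wellorder) (A : set (wo_mul omega W)) :
  small A <-> small [set y | exists k : nat, A (existT (fun _ => nat) y k)].
Proof.
split; move=> [n [f fI]].
  have /choice[g gP] (y : W) : exists k : nat,
      (exists k' : nat, A (existT (fun _ => nat) y k')) ->
      A (existT (fun _ => nat) y k).
    have [[k Ak]|nex] := pselect (exists k' : nat, A (existT (fun _ => nat) y k')).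
      by exists k.
    by exists 0.
  exists n, (fun y => f (existT (fun _ => nat) y (g y))) => x y /gP Ax /gP Ay xy.
  by apply: fI => //; exact: Relation_Operators.left_lex.
exists n.+1, (fun z => rcons_digit (f (projT1 z)) (projT2 z)).
move=> [x k] [y l] Ax Ay /wo_mul_ltP /= [xy|[<- kl]].
  by apply: rcons_digit_ltl; apply: fI => //; [exists k|exists l].
exact: rcons_digit_ltr.
Qed.

Lemma omega_mul_omega_omega :
  same_order_type (wo_mul omega omega_omega) omega_omega.
Proof.
apply: omega_omega_order_type.
  move=> /small_projection s; apply: omega_omega_not_small.
  by apply: sub_small s => x _; exists 0.
move=> [y k]; apply/small_projection.
apply: sub_small (small_setU (small_initial_segment y) (small_set1 y)).
by move=> x [l /wo_mul_ltP /= [xy|[-> _]]]; [left|right].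
Qed.

(** * The filter of sets with small complement *)

Lemma small_image_iso (V W : wellorder) (f : V -> W) (A : set V) :
  bijective f -> (forall x y, wo_lt x y <-> wo_lt (f x) (f y)) ->
  small (f @` A) <-> small A.
Proof.
move=> [g fK gK] fI; split.
  apply: (@small_comap _ _ _ _ f) => [x Ax|x y _ _ /fI //].
  by exists x.
apply: (@small_comap _ _ _ _ g); first by move=> _ [x Ax <-]; rewrite fK.
by move=> _ _ [x Ax <-] [y Ay <-] /fI; rewrite !fK.
Qed.

Lemma omega_omega_filterP (A : set omega_omega) :
  omega_omega_filter A <-> small (~` A).
Proof. exact: small_order_type_lt. Qed.

Lemma omega_omega_filter_proper : ProperFilter omega_omega_filter.
Proof.
apply: Build_ProperFilter.
  by move=> /omega_omega_filterP; rewrite setC0; exact: omega_omega_not_small.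
split.
- by apply/omega_omega_filterP; rewrite setCT; exists 0, (fun _ => tt).
- move=> A B /omega_omega_filterP sA /omega_omega_filterP sB.
  by apply/omega_omega_filterP; rewrite setCI; exact: small_setU.
- move=> A B AB /omega_omega_filterP sA; apply/omega_omega_filterP.
  by apply: sub_small sA; exact: subsetC.
Qed.

Lemma setC_image_bij (S T : Type) (f : S -> T) (A : set S) :
  bijective f -> ~` (f @` A) = f @` (~` A).
Proof.
move=> [g fK gK]; apply/seteqP; split=> [y nAy|_ [x nAx <-]].
  by exists (g y) => // Agy; apply: nAy; exists (g y).
by move=> [x' Ax' /(can_inj fK) e]; apply: nAx; rewrite -e.
Qed.

(** The largest set with trace [A] on [X] is the complement of what [A] misses in
[X]; its membership decides that of [A]. *)
Lemma restrictionP (S : Type) (F : set_system S) (X : set S) (A : set X) :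
  Filter F -> restriction F A <-> F (~` (val @` ~` A)).
Proof.
move=> FF; split=> [[B FB <-]|FA].
  by apply: filterS FB => x Bx [u /= nBu ux]; apply: nBu; rewrite ux.
exists (~` (val @` ~` A)) => //; apply/seteqP; split=> x /=.
  by move=> nx; apply: contrapT => nAx; apply: nx; exists x.
by move=> Ax [u nAu /val_inj ux]; apply: nAu; rewrite ux.
Qed.

(** The sets whose full fibres lie over a member of [F] already form a filter, so
no further sets are generated. *)
Lemma times_omegaP (S : Type) (F : set_system S) (B : set (S * nat)) :
  Filter F -> times_omega F B <-> F [set x | forall n, B (x, n)].
Proof.
move=> FF; split.
  move=> /(_ [set B | F [set x | forall n, B (x, n)]]); apply.
    split; last by move=> _ [A FA <-] /=; apply: (@filterS _ F) FA => x Ax n.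
    split=> /=.
    - by apply: (@filterS _ F) filterT => x _ n.
    - move=> P Q FP FQ; apply: (@filterS _ F) (@filterI _ F _ _ _ FP FQ) => x [Px Qx] n.
      by split.
    - by move=> P Q PQ; apply: (@filterS _ F) => x Px n; exact: PQ.
move=> FB M [FM subM].
apply: filterS (subM _ (ex_intro2 _ _ _ FB erefl)) => -[x n] [/= Bx _].
exact: Bx.
Qed.

Lemma omega_omega_homogeneous : homogeneous omega_omega_filter.
Proof.
have PF := omega_omega_filter_proper.
move=> X posX.
have nsX : ~ small X.
  move=> sX; have /posX[x []//] : omega_omega_filter (~` X).
  by apply/omega_omega_filterP; rewrite setCK.
have [|w|h [hbij hI]] := @omega_omega_order_type (wo_sub X).
- by rewrite small_wo_sub.
- by apply: (@small_comap (wo_sub X) omega_omega _ _ (fun x => val x) _ _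
    (small_initial_segment (val w))).
exists h; split=> // A; rewrite restrictionP !omega_omega_filterP setCK.
rewrite setC_image_bij// (small_image_iso _ hbij hI).
exact: (@small_val_image _ X).
Qed.

Lemma omega_omega_filter_times_omega :
  filter_iso omega_omega_filter (times_omega omega_omega_filter).
Proof.
have PF := omega_omega_filter_proper.
have [h [[g hK gK] hI]] := omega_mul_omega_omega.
have gbij : bijective g by exists h.
have gI x y : wo_lt x y <-> wo_lt (g x) (g y).
  by split=> [xy|/hI]; [apply/hI|]; rewrite !gK.
pose t x := (projT1 (g x), projT2 (g x)).
have tbij : bijective t.
  exists (fun p => h (existT (fun _ => nat) p.1 p.2)).
    by move=> x /=; rewrite -sigT_eta gK.
  by move=> [y k]; rewrite /t /= hK.
exists t; split=> // A; rewrite times_omegaP !omega_omega_filterP.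
rewrite -(small_image_iso _ gbij gI) small_projection.
suff -> : ~` [set y | forall k, (t @` A) (y, k)] =
    [set y | exists k : nat, (g @` ~` A) (existT (fun _ => nat) y k)] by [].
apply/seteqP; split=> y /=.
  move=> /existsNP[k nAk]; exists k, (h (existT (fun _ => nat) y k)) => // Ah.
  by apply: nAk; exists (h (existT (fun _ => nat) y k)); rewrite // /t hK.
move=> [k [x nAx gx]] /(_ k)[x' Ax' tx']; apply: nAx; suff -> : x = x' by [].
by apply: (bij_inj tbij); rewrite tx' /t gx.
Qed.

Theorem theorem3p1 :
  [/\ ProperFilter omega_omega_filter,
      homogeneous omega_omega_filter
    & filter_iso omega_omega_filter (times_omega omega_omega_filter)].
Proof.
split.
- exact: omega_omega_filter_proper.
- exact: omega_omega_homogeneous.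
- exact: omega_omega_filter_times_omega.
Qed.
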